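(* Let $p$ be an odd prime. For a sequence of elements of $\mathbb{Z}[1/p]$, let $[c_0,c_1,\dots]$ denote the $p$-adic limit of its convergents. (1) If $p\ge3$ and $t\ge2$, then for one of the two square roots $\sqrt{1-p^{t+2}}\in\mathbb{Q}_p$, $$\frac{\sqrt{1-p^{t+2}}}{2p}=\left[\frac{p^2-1}{2p},\overline{-\frac2p,-\frac1{p^{t-1}},\frac2p,-\frac1p}\right].$$ (2) If $p\ge5$ and $t\ge3$, then for one of the two square roots $\sqrt{p^t+1}\in\mathbb{Q}_p$, $$\frac{\sqrt{p^t+1}}{2}=\left[-\frac{p-1}2,\frac2p,\overline{-\frac1{p^{t-2}},1-\frac2p,-1-\frac2p,\frac1{p^{t-2}},-1+\frac2p,1+\frac2p}\right].$$ (3) If $p\ge5$ and $t\ge3$, then for one of the two square roots $\sqrt{p^t+1}\in\mathbb{Q}_p$, $$\frac{\sqrt{p^t+1}}{2p^{t-2}}=\left[\frac{p^{t-1}+1}{2p^{t-2}},\overline{1-\frac2p,-1-\frac2p,\frac1{p^{t-2}},-1+\frac2p,1+\frac2p,-\frac1{p^{t-2}}}\right].$$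
   Context: For a sequence $(c_n)_{n\ge0}$, the convergents are $A_n/B_n$ with $A_{-1}=1$, $A_0=c_0$, $B_{-1}=0$, $B_0=1$, $A_n=c_nA_{n-1}+A_{n-2}$, $B_n=c_nB_{n-1}+B_{n-2}$; an overline denotes a block repeated infinitely often. The notation ''$x=\pm[\dots]$'' in the paper means that the continued fraction equals $x$ for an appropriate choice of the sign of the square root.
   Formalization: In part (3) the first partial quotient is corrected to (p^{t-1}-1)/(2p^{t-2}); with the printed plus sign the limit is (s+2)/(2p^{t-2}) with s^2=p^t+1, whose numerator never squares to p^t+1, so the printed claim is false for all p and t. *)

(* Defs.v *)
From HB Require Import structures.
From mathcomp Require Import all_boot all_order all_algebra generic_quotient ring_quotient.
From mathcomp Require Import ring lra.
From mathcomp Require Import boolp classical_sets functions interval_inference reals topology.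
Set Implicit Arguments.
Unset Strict Implicit.
Unset Printing Implicit Defensive.
Import Order.TTheory GRing.Theory Num.Theory.
Local Open Scope ring_scope.

Definition padic_abs (p : nat) (q : rat) : rat :=
  if q == 0 then 0
  else p%:R ^ ((logn p `|denq q|%N)%:Z - (logn p `|numq q|%N)%:Z).

Section PadicAbs.
Variables (p : nat) (p_pr : prime p).
Local Notation "`| x |_p" := (padic_abs p x) (format "`| x |_p").

Let p_gt0 : 0 < p%:R :> rat.
Proof. by rewrite ltr0n prime_gt0. Qed.
Let p_neq0 : p%:R != 0 :> rat.
Proof. by rewrite gt_eqF. Qed.

Lemma padic_abs0 : `|0|_p = 0.
Proof. by rewrite /padic_abs eqxx. Qed.

Lemma padic_absE (a b : int) : a != 0 -> b != 0 ->
  `|a%:~R / b%:~R|_p = p%:R ^ ((logn p `|b|%N)%:Z - (logn p `|a|%N)%:Z).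
Proof.
move=> a0 b0; rewrite /padic_abs mulf_eq0 invr_eq0 !intr_eq0 (negPf a0) (negPf b0) /=.
set q : rat := a%:~R / b%:~R.
have q0 : q != 0 by rewrite mulf_neq0 ?invr_eq0 ?intr_eq0.
have : (numq q * b = a * denq q)%R.
  apply: (@intr_inj rat); rewrite !rmorphM /=.
  have : (numq q)%:~R / (denq q)%:~R = a%:~R / b%:~R :> rat by rewrite divq_num_den.
  by move/eqP; rewrite eqr_div ?intr_eq0 ?denq_neq0 // => /eqP.
move=> /(congr1 absz); rewrite !abszM => /(congr1 (logn p)).
rewrite !lognM ?absz_gt0 ?numq_eq0 ?denq_neq0 // => /(congr1 Posz).
rewrite !PoszD => h; congr (_ ^ _); apply/eqP.
by rewrite subr_eq addrAC eq_sym subr_eq addrC h addrC.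
Qed.

Lemma padic_abs_gt0 q : (0 < `|q|_p) = (q != 0).
Proof.
by rewrite /padic_abs; case: eqP => //= _; rewrite ?ltxx ?exprz_gt0.
Qed.

Lemma padic_abs_ge0 q : 0 <= `|q|_p.
Proof. by rewrite /padic_abs; case: eqP => //= _; rewrite ltW // exprz_gt0. Qed.

Lemma padic_abs_eq0 q : (`|q|_p == 0) = (q == 0).
Proof. by have := padic_abs_gt0 q; rewrite lt0r padic_abs_ge0 andbT => /(congr1 negb); rewrite !negbK. Qed.

Lemma padic_absN q : `|- q|_p = `|q|_p.
Proof. by rewrite /padic_abs oppr_eq0 numqN denqN abszN. Qed.

Lemma padic_absM q r : `|q * r|_p = `|q|_p * `|r|_p.
Proof.
have [->|q0] := eqVneq q 0; first by rewrite mul0r padic_abs0 mul0r.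
have [->|r0] := eqVneq r 0; first by rewrite mulr0 padic_abs0 mulr0.
rewrite -(divq_num_den q) -(divq_num_den r) mulf_div -!intrM.
rewrite !padic_absE ?mulf_neq0 ?numq_eq0 ?denq_neq0 //.
rewrite -expfzDr // !abszM !lognM ?absz_gt0 ?numq_eq0 ?denq_neq0 //.
by rewrite !PoszD opprD addrACA.
Qed.

Lemma padic_abs_int (a : int) : a != 0 ->
  `|a%:~R|_p = p%:R ^ (- (logn p `|a|%N)%:Z).
Proof.
move=> a0; have := @padic_absE a 1 a0 isT.
by rewrite divr1 logn1 sub0r.
Qed.

Lemma padic_abs1 : `|1|_p = 1.
Proof. by have := @padic_abs_int 1 isT; rewrite logn1 => ->. Qed.

Lemma padic_absV q : `|q^-1|_p = `|q|_p^-1.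
Proof.
have [->|q0] := eqVneq q 0; first by rewrite !invr0 ?padic_abs0 ?invr0.
apply: (mulIf (x := `|q|_p)); first by rewrite padic_abs_eq0.
by rewrite -padic_absM !mulVf ?padic_abs1 ?padic_abs_eq0.
Qed.

Lemma padic_abs_int_le1 (a : int) : `|a%:~R|_p <= 1.
Proof.
have [->|a0] := eqVneq a 0; first by rewrite padic_abs0.
rewrite padic_abs_int // -invr_expz.
by rewrite invf_le1 ?exprz_gt0 // -exprnP exprn_ege1 // ler1n (prime_gt0 p_pr).
Qed.

Lemma padic_absD_le q r : `|q + r|_p <= Num.max `|q|_p `|r|_p.
Proof.
wlog le_qr : q r / `|q|_p <= `|r|_p.
  by move=> H; case/orP: (le_total `|q|_p `|r|_p) => /H //; rewrite addrC maxC.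
rewrite (max_idPr le_qr).
have [r0|r0] := eqVneq r 0.
  have: `|q|_p == 0 by rewrite eq_le padic_abs_ge0 andbT -padic_abs0 -r0.
  by rewrite padic_abs_eq0 => /eqP ->; rewrite add0r.
suff H s : `|s|_p <= 1 -> `|s + 1|_p <= 1.
  have -> : q + r = (q / r + 1) * r by rewrite mulrDl mul1r divfK.
  rewrite padic_absM -[leRHS]mul1r ler_wpM2r ?padic_abs_ge0 // H //.
  by rewrite padic_absM padic_absV ler_pdivrMr ?mul1r // padic_abs_gt0.
have [->|s0] := eqVneq s 0; first by rewrite add0r padic_abs1.
move=> s1.
have nd : ~~ (p %| `|denq s|)%N.
  apply/negP => pd; move: s1; rewrite /padic_abs (negPf s0).
  have pn : ~~ (p %| `|numq s|)%N.
    apply/negP => pn; have := coprime_num_den s.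
    rewrite /coprime => /eqP h; have : (p %| 1)%N by rewrite -h dvdn_gcd pn pd.
    by rewrite dvdn1 => /eqP p1; move: p_pr; rewrite p1.
  rewrite [in X in _ - X]lognE (negPf pn) !andbF subr0 leNgt => /negP; apply.
  rewrite -exprnP exprn_egt1 // ?ltr1n ?prime_gt1 //.
  by rewrite -lt0n logn_gt0 mem_primes p_pr absz_gt0 denq_neq0.
have -> : s + 1 = (numq s + denq s)%:~R / (denq s)%:~R.
  by rewrite intrD mulrDl divff ?intr_eq0 ?denq_neq0 // divq_num_den.
rewrite padic_absM padic_absV.
rewrite (padic_abs_int (denq_neq0 s)).
rewrite lognE (negPf nd) !andbF oppr0 expr0z invr1 mulr1.
exact: padic_abs_int_le1.
Qed.

Lemma padic_absD_lt q r e : `|q|_p < e -> `|r|_p < e -> `|q + r|_p < e.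
Proof. by move=> qe re; rewrite (le_lt_trans (padic_absD_le _ _)) // gt_max qe. Qed.

Lemma padic_absB_lt q r e : `|q|_p < e -> `|r|_p < e -> `|q - r|_p < e.
Proof. by move=> qe re; rewrite padic_absD_lt // padic_absN. Qed.

Lemma padic_distC q r : `|q - r|_p = `|r - q|_p.
Proof. by rewrite -padic_absN opprB. Qed.

Lemma padic_dist_abs q r : `|q - r|_p < `|r|_p -> `|q|_p = `|r|_p.
Proof.
move=> h; apply/eqP; rewrite eq_le.
have -> /= : `|q|_p <= `|r|_p.
  by rewrite -(subrK r q) (le_trans (padic_absD_le _ _)) // ge_max (ltW h) lexx.
rewrite leNgt; apply/negP => h'.
have := padic_absB_lt h' h.
by rewrite opprB addrC subrK ltxx.
Qed.

Lemma padic_abs_dist q r : `| `|q|_p - `|r|_p | <= `|q - r|_p.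
Proof.
have [/padic_dist_abs ->|rqr] := ltP `|q - r|_p `|r|_p.
  by rewrite subrr normr0 padic_abs_ge0.
have [|qqr] := ltP `|q - r|_p `|q|_p.
  by rewrite padic_distC => /padic_dist_abs ->; rewrite subrr normr0 padic_abs_ge0.
have := padic_abs_ge0 q; have := padic_abs_ge0 r.
by rewrite ler_norml => ? ?; apply/andP; split; lra.
Qed.

End PadicAbs.

Section PadicNumbers.
Variables (p : nat) (p_pr : prime p).
Local Notation "`| x |_p" := (padic_abs p x) (format "`| x |_p").
Let absD_lt := padic_absD_lt p_pr.
Let absB_lt := padic_absB_lt p_pr.

Definition padic_cauchy (_ : prime p) : {pred nat -> rat} := fun u =>
  `[< forall e : rat, 0 < e -> exists N, forall m n,
        (N <= m)%N -> (N <= n)%N -> `|u m - u n|_p < e >].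
Local Notation cauchy := (padic_cauchy p_pr).

Lemma padic_cauchyP u : reflect (forall e : rat, 0 < e -> exists N, forall m n,
  (N <= m)%N -> (N <= n)%N -> `|u m - u n|_p < e) (u \in cauchy).
Proof. exact: asboolP. Qed.

Lemma padic_cauchy_bounded u : u \in cauchy ->
  exists2 M : rat, 0 < M & forall n, `|u n|_p < M.
Proof.
move=> /padic_cauchyP /(_ 1 ltr01) [N uN].
have S_ge0 k : 0 <= \sum_(i < k) `|u i|_p by rewrite sumr_ge0 // => i _; apply: padic_abs_ge0.
have bnd n : (n <= N)%N -> `|u n|_p < 1 + \sum_(i < N.+1) `|u i|_p.
  move=> nN; rewrite (bigD1 (Ordinal (nN : (n < N.+1)%N))) //= addrCA ltrDl.
  by rewrite ltr_pwDl // sumr_ge0 // => i _; apply: padic_abs_ge0.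
exists (1 + \sum_(i < N.+1) `|u i|_p); first by rewrite ltr_pwDl.
move=> n; have [/bnd //|/ltnW Nn] := leqP n N.
rewrite -(subrK (u N) (u n)) absD_lt ?bnd //.
by rewrite (lt_le_trans (uN _ _ Nn (leqnn N))) // lerDl.
Qed.

Lemma padic_cauchy_subring : subring_closed cauchy.
Proof.
split.
- apply/padic_cauchyP => e e0; exists 0%N => m n _ _.
  by rewrite subrr padic_abs0.
- move=> u v /padic_cauchyP uC /padic_cauchyP vC; apply/padic_cauchyP => e e0.
  have [N1 uN] := uC e e0; have [N2 vN] := vC e e0.
  exists (maxn N1 N2) => m n; rewrite !geq_max => /andP[m1 m2] /andP[n1 n2].
  have -> : (u - v) m - (u - v) n = (u m - u n) - (v m - v n).
    by rewrite !fctE; ring.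
  by rewrite absB_lt ?uN ?vN.
- move=> u v uC vC; apply/padic_cauchyP => e e0.
  have [A A0 uA] := padic_cauchy_bounded uC.
  have [B B0 vB] := padic_cauchy_bounded vC.
  move/padic_cauchyP: uC => /(_ (e / B)) []; first by rewrite divr_gt0.
  move/padic_cauchyP: vC => /(_ (e / A)) []; first by rewrite divr_gt0.
  move=> N2 vN N1 uN.
  exists (maxn N1 N2) => m n; rewrite !geq_max => /andP[m1 m2] /andP[n1 n2].
  have -> : (u * v) m - (u * v) n = (u m - u n) * v m + u n * (v m - v n).
    by rewrite mulrBl mulrBr addrA subrK.
  apply: absD_lt; rewrite padic_absM //.
    rewrite (le_lt_trans (ler_wpM2l (padic_abs_ge0 _ _) (ltW (vB m)))) //.
    by rewrite -ltr_pdivlMr // uN.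
  rewrite (le_lt_trans (ler_wpM2r (padic_abs_ge0 _ _) (ltW (uA n)))) //.
  by rewrite mulrC -ltr_pdivlMr // vN.
Qed.

HB.instance Definition _ := GRing.isSubringClosed.Build (nat -> rat)
  (padic_cauchy p_pr) padic_cauchy_subring.

Record padic_cauchy_seq := PadicCauchySeq {
  padic_cauchy_val :> nat -> rat;
  padic_cauchy_valP : padic_cauchy_val \in cauchy }.

HB.instance Definition _ := [isSub for padic_cauchy_val].
HB.instance Definition _ := [Choice of padic_cauchy_seq by <:].
HB.instance Definition _ := [SubChoice_isSubComNzRing of padic_cauchy_seq by <:].

Definition padic_null : {pred padic_cauchy_seq} := fun u =>
  `[< forall e : rat, 0 < e -> exists N, forall n,
        (N <= n)%N -> `|u n|_p < e >].

Lemma padic_nullP (u : padic_cauchy_seq) : reflect (forall e : rat, 0 < e -> exists N, forall n,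
  (N <= n)%N -> `|u n|_p < e) (u \in padic_null).
Proof. exact: asboolP. Qed.

Lemma padic_null_ideal : idealr_closed padic_null.
Proof.
split.
- by apply/padic_nullP => e e0; exists 0%N => n _; rewrite padic_abs0.
- apply/negP => /padic_nullP /(_ 1 ltr01) [N /(_ N (leqnn N))].
  by rewrite padic_abs1 ltxx.
- move=> a u v /padic_nullP u0 /padic_nullP v0; apply/padic_nullP => e e0.
  have [A A0 aA] := padic_cauchy_bounded (padic_cauchy_valP a).
  have [|N1 uN] := u0 (e / A); first by rewrite divr_gt0.
  have [N2 vN] := v0 e e0.
  exists (maxn N1 N2) => n; rewrite geq_max => /andP[n1 n2].
  apply: absD_lt; last exact: vN.
  rewrite [X in `|X|_p](_ : _ = a n * u n) // padic_absM //.
  rewrite (le_lt_trans (ler_wpM2r (padic_abs_ge0 _ _) (ltW (aA n)))) //.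
  by rewrite mulrC -ltr_pdivlMr // uN.
Qed.

HB.instance Definition _ := isIdealr.Build padic_cauchy_seq padic_null
  padic_null_ideal.

Definition Qp := {ideal_quot padic_null}.
HB.instance Definition _ := GRing.ComNzRing.on Qp.

Definition Qp_of (u : padic_cauchy_seq) : Qp := \pi_{ideal_quot padic_null}%qT u.

Lemma Qp_of_zmod_morphism : zmod_morphism Qp_of.
Proof. exact: pi_is_zmod_morphism. Qed.
Lemma Qp_of_monoid_morphism : monoid_morphism Qp_of.
Proof. exact: pi_is_monoid_morphism. Qed.
HB.instance Definition _ := GRing.isZmodMorphism.Build padic_cauchy_seq Qp Qp_of
  Qp_of_zmod_morphism.
HB.instance Definition _ := GRing.isMonoidMorphism.Build padic_cauchy_seq Qp Qp_of
  Qp_of_monoid_morphism.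

Lemma Qp_ofP (x : Qp) : exists u, x = Qp_of u.
Proof. by exists (repr (x : {ideal_quot padic_null})); rewrite /Qp_of reprK. Qed.

Lemma Qp_of_eq0 u : (Qp_of u == 0) = (u \in padic_null).
Proof.
have -> : 0 = Qp_of 0 by rewrite rmorph0.
by rewrite /Qp_of -Quotient.idealrBE subr0.
Qed.

Lemma padic_abs_stable (u : padic_cauchy_seq) : u \notin padic_null ->
  exists2 a, 0 < a & exists N, forall n, (N <= n)%N -> `|u n|_p = a.
Proof.
move/asboolPn => /existsNP [e] /not_implyP [e0] /forallNP nu.
have /padic_cauchyP /(_ e e0) [N uN] := padic_cauchy_valP u.
have /existsNP [k /not_implyP [Nk /negP uk]] := nu N.
rewrite -leNgt in uk.
exists `|u k|_p; first exact: lt_le_trans uk.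
exists N => n Nn; apply: (padic_dist_abs p_pr).
exact: lt_le_trans (uN _ _ Nn Nk) uk.
Qed.

Lemma Qp_inv_subproof (x : Qp) : x != 0 -> exists y, y * x = 1.
Proof.
have [u ->] := Qp_ofP x; rewrite Qp_of_eq0 => /padic_abs_stable [a a0 [N uN]].
have unz n : (N <= n)%N -> u n != 0.
  by move=> /uN ua; rewrite -(padic_abs_eq0 p_pr) ua gt_eqF.
have vC : (fun n => (u n)^-1) \in cauchy.
  apply/padic_cauchyP => e e0.
  have /padic_cauchyP /(_ (e * (a * a))) [|N' uN'] := padic_cauchy_valP u.
    by rewrite !mulr_gt0.
  exists (maxn N N') => m n; rewrite !geq_max => /andP[m1 m2] /andP[n1 n2].
  have -> : (u m)^-1 - (u n)^-1 = (u n - u m) / (u m * u n).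
    by field; rewrite !unz.
  rewrite padic_absM // padic_absV // padic_absM // !uN //.
  by rewrite ltr_pdivrMr ?mulr_gt0 // uN'.
exists (Qp_of (PadicCauchySeq vC)).
rewrite -rmorphM -(rmorph1 Qp_of); apply/eqP; rewrite -subr_eq0 -rmorphB Qp_of_eq0.
apply/padic_nullP => e e0; exists N => n Nn.
rewrite [X in `|X|_p](_ : _ = (u n)^-1 * u n - 1) //.
by rewrite mulVf ?unz // subrr padic_abs0.
Qed.

Definition Qp_inv (x : Qp) : Qp := xget 0 [set y | y * x = 1].

Lemma Qp_mulVf x : x != 0 -> Qp_inv x * x = 1.
Proof. by move=> /Qp_inv_subproof x0; have := xgetPex 0 x0. Qed.

Lemma Qp_invr0 : Qp_inv 0 = 0.
Proof.
rewrite /Qp_inv xgetPN // => y /=; rewrite mulr0 => /eqP.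
by rewrite eq_sym oner_eq0.
Qed.

HB.instance Definition _ := GRing.ComNzRing_isField.Build Qp Qp_mulVf Qp_invr0.

Lemma padic_cst_cauchy (q : rat) : (fun=> q) \in cauchy.
Proof. by apply/padic_cauchyP => e e0; exists 0%N => *; rewrite subrr padic_abs0. Qed.

Definition Qp_rat (q : rat) : Qp := Qp_of (PadicCauchySeq (padic_cst_cauchy q)).

Lemma Qp_rat_zmod_morphism : zmod_morphism Qp_rat.
Proof. by move=> q r; rewrite /Qp_rat -rmorphB; congr Qp_of; apply/val_inj. Qed.
Lemma Qp_rat_monoid_morphism : monoid_morphism Qp_rat.
Proof.
split; first by rewrite -(rmorph1 Qp_of) /Qp_rat; congr Qp_of; apply/val_inj.
by move=> q r; rewrite /Qp_rat -rmorphM; congr Qp_of; apply/val_inj.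
Qed.
HB.instance Definition _ := GRing.isZmodMorphism.Build rat Qp Qp_rat
  Qp_rat_zmod_morphism.
HB.instance Definition _ := GRing.isMonoidMorphism.Build rat Qp Qp_rat
  Qp_rat_monoid_morphism.

Lemma Qp_ratE q : ratr q = Qp_rat q.
Proof. by rewrite -(fmorph_eq_rat Qp_rat). Qed.

Lemma Qp_pchar : [pchar Qp] =i pred0.
Proof. by move=> n; rewrite (fmorph_pchar Qp_rat) pchar_num. Qed.

(* The limit of |u_n|_p, for any Cauchy sequence u representing x: the sequence
   |u_n|_p is eventually constant unless it tends to 0, so its limit is rational. *)
Definition Qp_abs (x : Qp) : rat :=
  xget 0 [set a | exists2 u : padic_cauchy_seq, x = Qp_of u &
    forall e, 0 < e -> exists N, forall n, (N <= n)%N -> `| `|u n|_p - a | < e].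

Lemma Qp_abs_of (u : padic_cauchy_seq) a :
  (forall e, 0 < e -> exists N, forall n, (N <= n)%N -> `| `|u n|_p - a | < e) ->
  Qp_abs (Qp_of u) = a.
Proof.
move=> ua; apply: xget_unique => /=; first by exists u.
move=> b [v uv vb]; apply/eqP; rewrite -subr_eq0 -normr_eq0; apply/negPn/negP => ab.
set e := `|b - a| / 3%:R.
have e0 : 0 < e by rewrite divr_gt0 // lt0r ab normr_ge0.
have [N1 uN] := ua e e0; have [N2 vN] := vb e e0.
have /padic_nullP /(_ e e0) [N3 uvN] : u - v \in padic_null.
  by rewrite -Qp_of_eq0 rmorphB /= -uv subrr.
pose n := maxn N1 (maxn N2 N3).
have {}uN : `| `|u n|_p - a | < e by apply: uN; rewrite leq_maxl.
have {}vN : `| `|v n|_p - b | < e by apply: vN; rewrite !leq_max leqnn orbT.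
have {}uvN : `| `|u n|_p - `|v n|_p | < e.
  apply: le_lt_trans (padic_abs_dist p_pr _ _) (uvN n _).
  by rewrite !leq_max leqnn !orbT.
have : `|b - a| < e + e + e.
  have -> : b - a = (`|u n|_p - a) - (`|u n|_p - `|v n|_p) - (`|v n|_p - b) by ring.
  rewrite (le_lt_trans (ler_normB _ _)) // ltrD //.
  by rewrite (le_lt_trans (ler_normB _ _)) // ltrD.
suff -> : e + e + e = `|b - a| by rewrite ltxx.
by rewrite /e; field.
Qed.

Lemma Qp_abs0 : Qp_abs 0 = 0.
Proof.
rewrite -(rmorph0 Qp_of); apply: Qp_abs_of => e e0; exists 0%N => n _.
by rewrite [X in `|X|_p](_ : _ = 0) // padic_abs0 subrr normr0.
Qed.

Lemma Qp_abs_stable (u : padic_cauchy_seq) : Qp_of u != 0 -> 0 < Qp_abs (Qp_of u) /\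
  exists N, forall n, (N <= n)%N -> `|u n|_p = Qp_abs (Qp_of u).
Proof.
rewrite Qp_of_eq0 => /padic_abs_stable [a a0 [N uN]].
have -> : Qp_abs (Qp_of u) = a.
  apply: Qp_abs_of => e e0; exists N => n /uN ->.
  by rewrite subrr normr0.
by split => //; exists N.
Qed.

Lemma Qp_abs_gt0 x : (0 < Qp_abs x) = (x != 0).
Proof.
have [->|] := eqVneq x 0; first by rewrite Qp_abs0 ltxx.
by have [u ->] := Qp_ofP x => /Qp_abs_stable [].
Qed.

Lemma Qp_abs_ge0 x : 0 <= Qp_abs x.
Proof.
have [->|] := eqVneq x 0; first by rewrite Qp_abs0.
by rewrite -Qp_abs_gt0 => /ltW.
Qed.

Lemma Qp_abs_eq0 x : (Qp_abs x == 0) = (x == 0).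
Proof.
by have := Qp_abs_gt0 x; rewrite lt0r Qp_abs_ge0 andbT => /(congr1 negb); rewrite !negbK.
Qed.

Lemma Qp_abs_rat (q : rat) : Qp_abs (ratr q) = `|q|_p.
Proof.
rewrite Qp_ratE; apply: Qp_abs_of => e e0; exists 0%N => n _.
by rewrite subrr normr0.
Qed.

Lemma Qp_absM x y : Qp_abs (x * y) = Qp_abs x * Qp_abs y.
Proof.
have [->|] := eqVneq x 0; first by rewrite mul0r Qp_abs0 mul0r.
have [->|] := eqVneq y 0; first by rewrite mulr0 Qp_abs0 mulr0.
have [u ->] := Qp_ofP x; have [v ->] := Qp_ofP y.
move=> /Qp_abs_stable [_ [N2 vN]] /Qp_abs_stable [_ [N1 uN]].
rewrite -rmorphM; apply: Qp_abs_of => e e0; exists (maxn N1 N2) => n.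
rewrite geq_max => /andP[/uN un /vN vn].
rewrite [X in `|X|_p](_ : _ = u n * v n) // padic_absM // un vn.
by rewrite subrr normr0.
Qed.

Lemma Qp_absN x : Qp_abs (- x) = Qp_abs x.
Proof.
rewrite -mulN1r Qp_absM -(rmorph1 Qp_rat) -rmorphN /= -Qp_ratE Qp_abs_rat.
by rewrite padic_absN padic_abs1 mul1r.
Qed.

Lemma Qp_absD_le x y : Qp_abs (x + y) <= Num.max (Qp_abs x) (Qp_abs y).
Proof.
have [->|] := eqVneq x 0; first by rewrite add0r le_max lexx orbT.
have [->|] := eqVneq y 0; first by rewrite addr0 le_max lexx.
have [->|] := eqVneq (x + y) 0; first by rewrite Qp_abs0 le_max Qp_abs_ge0.
have [u ->] := Qp_ofP x; have [v ->] := Qp_ofP y; rewrite -rmorphD.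
move=> /Qp_abs_stable [_ [N3 uvN]] /Qp_abs_stable [_ [N2 vN]] /Qp_abs_stable [_ [N1 uN]].
pose n := maxn N1 (maxn N2 N3).
rewrite -(uN n) ?leq_maxl // -(vN n) ?leq_max ?leqnn ?orbT //.
rewrite -(uvN n) ?leq_max ?leqnn ?orbT //.
exact: padic_absD_le.
Qed.

Lemma Qp_ball_center x e : 0 < e -> ball_ Qp_abs x e x.
Proof. by move=> e0; rewrite /ball_ /= subrr Qp_abs0. Qed.

Lemma Qp_ball_sym x y e : ball_ Qp_abs x e y -> ball_ Qp_abs y e x.
Proof. by rewrite /ball_ /= -Qp_absN opprB. Qed.

Lemma Qp_ball_triangle x y z e1 e2 :
  ball_ Qp_abs x e1 y -> ball_ Qp_abs y e2 z -> ball_ Qp_abs x (e1 + e2) z.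
Proof.
rewrite /ball_ /= => xy yz; rewrite -(subrK y x) -addrA.
rewrite (le_lt_trans (Qp_absD_le _ _)) // gt_max.
rewrite (lt_le_trans xy) ?(lt_le_trans yz) ?lerDl ?lerDr //.
  exact: le_trans (Qp_abs_ge0 _) (ltW xy).
exact: le_trans (Qp_abs_ge0 _) (ltW yz).
Qed.

HB.instance Definition _ := hasNbhs.Build Qp (nbhs_ball_ (ball_ Qp_abs)).
Lemma Qp_nbhsE : @nbhs Qp Qp = nbhs_ (entourage_ (ball_ Qp_abs)).
Proof.
apply/funext => x; apply/seteqP; split => A.
- by move=> [e e0 xA]; exists [set xy : Qp * Qp | ball_ Qp_abs xy.1 e xy.2]%classic; [exists e|
    move=> y /xsectionP; exact: xA].
- by move=> [B [e e0 eB] BA]; exists e => // y xy; apply: BA; apply/xsectionP/eB.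
Qed.
HB.instance Definition _ := Nbhs_isPseudoMetric.Build rat Qp Qp_nbhsE
  Qp_ball_center Qp_ball_sym Qp_ball_triangle erefl.

Lemma Qp_ballE (x y : Qp) (e : rat) : ball x e y = (Qp_abs (x - y) < e) :> Prop.
Proof. by []. Qed.

Lemma Qp_of_dist_lt (u : padic_cauchy_seq) e N :
  (forall m n, (N <= m)%N -> (N <= n)%N -> `|u m - u n|_p < e) ->
  forall n, (N <= n)%N -> Qp_abs (Qp_of u - ratr (u n)) < e.
Proof.
move=> uN n Nn; rewrite Qp_ratE /Qp_rat -rmorphB /=; set w := (X in Qp_of X).
have [->|/Qp_abs_stable [_ [N' uN']]] := eqVneq (Qp_of w) 0.
  by rewrite Qp_abs0 (le_lt_trans (padic_abs_ge0 _ _) (uN _ _ Nn Nn)).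
rewrite -(uN' (maxn N N')) ?leq_maxr //.
by apply: uN; rewrite ?leq_maxl.
Qed.

Lemma Qp_of_cvg (u : padic_cauchy_seq) :
  ((fun n => ratr (u n) : Qp) @ \oo --> Qp_of u)%classic.
Proof.
apply/cvg_ballP => e e0.
have /padic_cauchyP /(_ e e0) [N uN] := padic_cauchy_valP u.
by exists N => // n Nn; exact: (@Qp_of_dist_lt u e N uN n Nn).
Qed.

Lemma Qp_hausdorff : hausdorff_space Qp.
Proof.
rewrite ball_hausdorff => x y xy.
have xy0 : 0 < Qp_abs (x - y) by rewrite Qp_abs_gt0 subr_eq0.
exists (PosNum xy0, PosNum xy0) => /=; apply/eqP/seteqP; split => // z [/= xz yz].
have : Qp_abs (x - z + (z - y)) < Qp_abs (x - y).
  by rewrite (le_lt_trans (Qp_absD_le _ _)) // gt_max xz -Qp_absN opprB.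
by rewrite addrA subrK ltxx.
Qed.

Lemma Qp_dense x e : 0 < e -> exists q : rat, Qp_abs (x - ratr q) < e.
Proof.
move=> e0; have [u ->] := Qp_ofP x.
have /padic_cauchyP /(_ e e0) [N uN] := padic_cauchy_valP u.
by exists (u N); exact: (@Qp_of_dist_lt u e N uN N).
Qed.

Lemma Qp_complete (x : nat -> Qp) :
  (forall e : rat, 0 < e -> exists N, forall m n, (N <= m)%N -> (N <= n)%N ->
     Qp_abs (x m - x n) < e) ->
  exists l : Qp, (x @ \oo --> l)%classic.
Proof.
move=> xC.
have harm (e : rat) : 0 < e -> exists N, forall n, (N <= n)%N -> n.+1%:R^-1 < e.
  move=> e0; exists (Num.truncn e^-1) => n Nn.
  rewrite -[e]invrK ltf_pV2 ?posrE ?ltr0n ?invr_gt0 //.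
  by rewrite (lt_le_trans (truncnS_gt _)) // ler_nat.
have /choice [q xq] : forall n, exists q : rat, Qp_abs (x n - ratr q) < n.+1%:R^-1.
  by move=> n; apply: Qp_dense; rewrite invr_gt0 ltr0n.
have D_lt (a b : Qp) e : Qp_abs a < e -> Qp_abs b < e -> Qp_abs (a + b) < e.
  by move=> ae be; rewrite (le_lt_trans (Qp_absD_le _ _)) // gt_max ae.
have qC : q \in cauchy.
  apply/padic_cauchyP => e e0; have [N1 xN] := xC e e0; have [N2 hN] := harm e e0.
  exists (maxn N1 N2) => m n; rewrite !geq_max => /andP[m1 m2] /andP[n1 n2].
  rewrite -Qp_abs_rat Qp_ratE rmorphB /= -!Qp_ratE.
  have -> : ratr (q m) - ratr (q n) =
      - (x m - ratr (q m)) + (x m - x n) + (x n - ratr (q n)) by ring.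
  apply: (D_lt); last exact: lt_trans (xq n) (hN n n2).
  apply: D_lt; last exact: xN.
  by rewrite Qp_absN; exact: lt_trans (xq m) (hN m m2).
exists (Qp_of (PadicCauchySeq qC)); apply/cvg_ballP => e e0.
have [N2 hN] := harm e e0.
have /padic_cauchyP /(_ e e0) [N1 qN] := qC.
exists (maxn N1 N2) => // n /=; rewrite geq_max => /andP[n1 n2].
rewrite Qp_ballE -(subrK (ratr (q n)) (Qp_of _)) -addrA D_lt //.
  exact: (@Qp_of_dist_lt (PadicCauchySeq qC) e N1 qN n n1).
by rewrite -Qp_absN opprB; exact: lt_trans (xq n) (hN n n2).
Qed.

End PadicNumbers.

(* cf_num c n = A_(n-1) and cf_den c n = B_(n-1): indices are shifted by one so
   as to start from A_(-1) and B_(-1). *)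
Fixpoint cf_num (c : nat -> rat) (n : nat) : rat :=
  match n with
  | 0 => 1
  | 1 => c 0%N
  | (m.+1 as k).+1 => c k * cf_num c k + cf_num c m
  end.

Fixpoint cf_den (c : nat -> rat) (n : nat) : rat :=
  match n with
  | 0 => 0
  | 1 => 1
  | (m.+1 as k).+1 => c k * cf_den c k + cf_den c m
  end.

Definition convergent (c : nat -> rat) (n : nat) : rat :=
  cf_num c n.+1 / cf_den c n.+1.

(* The nonvanishing of the B_n rules out the convention x / 0 = 0 *)
Definition padic_cf (p : nat) (p_pr : prime p) (c : nat -> rat) (x : Qp p_pr) :=
  (forall n, cf_den c n.+1 != 0) /\
  ((fun n => ratr (convergent c n) : Qp p_pr) @ \oo --> x)%classic.

Definition eventually_periodic (pre per : seq rat) (n : nat) : rat :=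
  if (n < size pre)%N then pre`_n else per`_((n - size pre) %% size per).

(* On the expansion of s / (2 p^(t-2)), where s^2 = p^t + 1: with the period
   1 - 2/p, -1 - 2/p, 1/p^(t-2), -1 + 2/p, 1 + 2/p, -1/p^(t-2), the first partial
   quotient is (p^(t-1) - 1) / (2 p^(t-2)), with a minus sign. With a plus sign the
   limit is (s + 2) / (2 p^(t-2)), and (s + 2)^2 = p^t + 1 would force s = -1. *)

(* Main.v *)
Require Import Defs.
From mathcomp Require Import all_boot all_order all_algebra.
From mathcomp Require Import ring.
Import GRing.Theory Num.Theory.
Import Order.TTheory.
Local Open Scope ring_scope.

(* All partial quotients but the first have p-adic absolute value at least p, so
   |B_n| >= p^n and the convergents form a Cauchy sequence. If D is the claimed
   square of the limit, shifting by one period multiplies A_n + B_n sqrt(D) by a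
   fixed element a + b sqrt(D) of norm 1. Hence A_n^2 - D B_n^2 takes finitely many
   values, and (A_n / B_n)^2 - D = (A_n^2 - D B_n^2) / B_n^2 tends to 0. *)

(** * Recurrences and determinant of the convergents *)

Lemma cf_numS c n : cf_num c n.+2 = c n.+1 * cf_num c n.+1 + cf_num c n.
Proof. by []. Qed.

Lemma cf_denS c n : cf_den c n.+2 = c n.+1 * cf_den c n.+1 + cf_den c n.
Proof. by []. Qed.

Lemma cf_det c n :
  cf_num c n.+1 * cf_den c n - cf_num c n * cf_den c n.+1 = (-1) ^+ n.+1.
Proof.
elim: n => [|n IH]; first by rewrite /= mulr0 mul1r sub0r expr1.
rewrite cf_numS cf_denS [RHS]exprS -IH; ring.
Qed.

(** * Convergence when the partial quotients are p-adically large *)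

Section PadicConvergence.
Variables (p : nat) (p_pr : prime p) (c : nat -> rat).
Hypothesis c_ge : forall n, p%:R <= padic_abs p (c n.+1).

Let p_gt1 : 1 < p%:R :> rat. Proof. by rewrite ltr1n prime_gt1. Qed.
Let p_gt0 : 0 < p%:R :> rat. Proof. by rewrite ltr0n prime_gt0. Qed.

(** In the recurrence for B_(n+1) the term c_(n+1) B_n strictly dominates, so the ultrametric
    inequality is an equality. The first bound is carried through the induction because dominance
    needs |B_(n-1)| < |B_n|. *)
Lemma cf_den_abs_ge n :
  p%:R * padic_abs p (cf_den c n) <= padic_abs p (cf_den c n.+1) /\
  p%:R ^+ n <= padic_abs p (cf_den c n.+1).
Proof.
elim: n => [|n [IH1 IH2]]; first by rewrite /= padic_abs0 padic_abs1 mulr0.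
have B0 : 0 < padic_abs p (cf_den c n.+1).
  by apply: lt_le_trans IH2; rewrite exprn_gt0.
have B_lt : padic_abs p (cf_den c n) < padic_abs p (cf_den c n.+1).
  (* B_(-1) = 0 is treated apart: multiplying 0 by p > 1 gives no strict inequality. *)
  have [->|B1] := eqVneq (cf_den c n) 0; first by rewrite padic_abs0.
  by apply: lt_le_trans IH1; rewrite ltr_pMl // padic_abs_gt0.
have cB_ge : p%:R * padic_abs p (cf_den c n.+1)
             <= padic_abs p (c n.+1 * cf_den c n.+1).
  by rewrite padic_absM // ler_wpM2r // ltW.
have -> : padic_abs p (cf_den c n.+2) = padic_abs p (c n.+1 * cf_den c n.+1).
  apply: padic_dist_abs => //; rewrite cf_denS addrC addKr.
  by rewrite (lt_le_trans B_lt) // (le_trans _ cB_ge) // ler_peMl // ltW.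
by split=> //; rewrite exprS (le_trans _ cB_ge) // ler_wpM2l // ltW.
Qed.

Lemma cf_den_neq0 n : cf_den c n.+1 != 0.
Proof.
rewrite -(padic_abs_gt0 p_pr); have [_] := cf_den_abs_ge n.
by apply: lt_le_trans; rewrite exprn_gt0.
Qed.

(** By the determinant identity the difference is 1 / (B_n B_(n+1)) up to sign, and |B_n B_(n+1)| >=
    p^(2n+1). *)
Lemma convergent_dist n :
  padic_abs p (convergent c n.+1 - convergent c n) < p%:R ^- n.
Proof.
have B1 := cf_den_neq0 n; have B2 := cf_den_neq0 n.+1.
have -> : convergent c n.+1 - convergent c n =
    (-1) ^+ n.+2 / (cf_den c n.+2 * cf_den c n.+1).
  by rewrite -(cf_det c) /convergent; field; rewrite B1 B2.
rewrite padic_absM // padic_absV // padic_absM //.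
have -> : padic_abs p ((-1) ^+ n.+2) = 1.
  by rewrite -signr_odd; case: odd; rewrite ?expr1 ?padic_absN padic_abs1.
rewrite mul1r ltf_pV2 ?posrE ?mulr_gt0 ?padic_abs_gt0 ?exprn_gt0 //.
have [_ B1_ge] := cf_den_abs_ge n; have [_ B2_ge] := cf_den_abs_ge n.+1.
apply: (lt_le_trans (y := p%:R ^+ n.+1 * p%:R ^+ n)); last first.
  by rewrite ler_pM // ltW // exprn_gt0.
by rewrite ltr_pMl ?exprn_gt0 // exprn_egt1.
Qed.

(** The ultrametric inequality keeps the one-step bounds from accumulating. *)
Lemma convergent_tail_dist N n : (N <= n)%N ->
  padic_abs p (convergent c n - convergent c N) < p%:R ^- N.
Proof.
move=> /subnK <-; elim: (n - N)%N => [|k IH].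
  by rewrite add0n subrr padic_abs0 invr_gt0 exprn_gt0.
rewrite addSn -(subrK (convergent c (k + N)) (convergent c (k + N).+1)) -addrA.
apply: (padic_absD_lt p_pr) => //; apply: (lt_le_trans (convergent_dist _)).
by rewrite lef_pV2 ?posrE ?exprn_gt0 // ler_eXn2l // leq_addl.
Qed.

Lemma exprn_gt_archi (e : rat) : exists N, e < p%:R ^+ N.
Proof.
exists (Num.bound e); apply: lt_le_trans (upper_nthrootP (leqnn _)) _.
by rewrite lerXn2r ?nnegrE // ler_nat prime_gt1.
Qed.

Lemma convergent_cauchy : convergent c \in padic_cauchy p_pr.
Proof.
apply/padic_cauchyP => e e0; have [N N_gt] := exprn_gt_archi e^-1.
have N_lt : p%:R ^- N < e.
  by rewrite -[e]invrK ltf_pV2 ?posrE ?invr_gt0 ?exprn_gt0.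
exists N => m n Nm Nn; apply: lt_trans N_lt.
rewrite -(subrK (convergent c N) (convergent c m)) -addrA.
apply: (padic_absD_lt p_pr); first exact: convergent_tail_dist.
by rewrite padic_distC; exact: convergent_tail_dist.
Qed.

(** No square root of D is constructed beforehand: the limit of the convergents is one, since their
    squares minus D form a null sequence. *)
Lemma padic_cf_sqrt (D M : rat) :
  (forall n, padic_abs p (cf_num c n ^+ 2 - D * cf_den c n ^+ 2) <= M) ->
  exists2 x : Qp p_pr, x ^+ 2 = ratr D & padic_cf c x.
Proof.
move=> norm_le; pose u := PadicCauchySeq convergent_cauchy.
exists (Qp_of u); last by split; [exact: cf_den_neq0 | exact: (@Qp_of_cvg p p_pr u)].
apply/eqP; rewrite -subr_eq0 Qp_ratE -rmorphXn -rmorphB Qp_of_eq0.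
apply/padic_nullP => e e0; have [N N_gt] := exprn_gt_archi (M / e).
exists N => n Nn.
rewrite [X in padic_abs p X](_ : _ =
  (cf_num c n.+1 ^+ 2 - D * cf_den c n.+1 ^+ 2) / cf_den c n.+1 ^+ 2); last first.
  rewrite [LHS](_ : _ = convergent c n ^+ 2 - D) //.
  by rewrite /convergent; field; exact: cf_den_neq0.
have [_ B_ge] := cf_den_abs_ge n.
rewrite padic_absM // padic_absV // ltr_pdivrMr; last first.
  by rewrite padic_abs_gt0 // expf_neq0 // cf_den_neq0.
apply: (le_lt_trans (norm_le n.+1)); rewrite -ltr_pdivrMl // mulrC.
apply: (lt_le_trans N_gt); rewrite expr2 padic_absM //.
(* One factor |B_n| >= p^n is enough; the other is only bounded below by 1. *)
apply: (le_trans (y := p%:R ^+ n * 1)).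
  by rewrite mulr1 ler_weXn2l // ltW.
apply: ler_pM => //; first by rewrite exprn_ge0 // ltW.
by apply: le_trans B_ge; rewrite exprn_ege1 // ltW.
Qed.
End PadicConvergence.

(** * Periodicity and the norm form *)

(** Past index k both sides of the shift relations satisfy the same second-order linear recurrence,
    so two consecutive indices suffice. *)
Lemma cf_norm_bounded (p : nat) (c : nat -> rat) (k l : nat) (D a b : rat) :
  (0 < l)%N -> (forall n, (k < n)%N -> c (n + l)%N = c n) ->
  a ^+ 2 - D * b ^+ 2 = 1 ->
  (forall i, (i < 2)%N ->
    cf_num c (i + k + l) = a * cf_num c (i + k) + D * b * cf_den c (i + k) /\
    cf_den c (i + k + l) = b * cf_num c (i + k) + a * cf_den c (i + k)) ->
  exists M, forall n, padic_abs p (cf_num c n ^+ 2 - D * cf_den c n ^+ 2) <= M.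
Proof.
move=> l_gt0 c_per ab1 base.
have shift m :
    cf_num c (m + k + l) = a * cf_num c (m + k) + D * b * cf_den c (m + k) /\
    cf_den c (m + k + l) = b * cf_num c (m + k) + a * cf_den c (m + k).
  elim/ltn_ind: m => -[|[|m]] IH; [exact: base | exact: base |].
  have [A0 B0] := IH m (leqW (leqnn _)); have [A1 B1] := IH m.+1 (leqnn _).
  rewrite !addSn in A1 B1 *; rewrite !cf_numS !cf_denS A0 A1 B0 B1 -!addSn c_per.
    by split; ring.
  by rewrite addSn ltnS leq_addl.
set N := fun n => padic_abs p (cf_num c n ^+ 2 - D * cf_den c n ^+ 2).
have N_per m : N (m + k + l)%N = N (m + k)%N.
  have [A B] := shift m; rewrite /N A B; congr padic_abs.
  (* Multiplicativity of the norm: (aA + DbB)^2 - D(bA + aB)^2 = (a^2 - Db^2)(A^2 - DB^2). *)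
  by rewrite -[RHS]mul1r -ab1; ring.
have N_le i : (i < k + l)%N -> N i <= \sum_(j < k + l) N j.
  move=> i_lt; rewrite (bigD1 (Ordinal i_lt)) //= lerDl sumr_ge0 // => j _.
  exact: padic_abs_ge0.
(* The sum of the nonnegative values below k + l serves as their upper bound; larger indices descend
   by l. *)
exists (\sum_(j < k + l) N j) => n; rewrite -/(N n).
elim/ltn_ind: n => n IH; have [/N_le //|kl_le] := ltnP n (k + l).
have n_eq : n = (n - (k + l) + k + l)%N by rewrite -addnA subnK.
rewrite n_eq N_per; apply: IH.
by rewrite [X in (_ < X)%N]n_eq -[X in (X < _)%N]addn0 ltn_add2l.
Qed.

Lemma eventually_periodicD (pre per : seq rat) n : (size pre <= n)%N ->
  eventually_periodic pre per (n + size per) = eventually_periodic pre per n.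
Proof.
move=> n_ge; rewrite /eventually_periodic !ltnNge n_ge.
rewrite (leq_trans n_ge) ?leq_addr //=.
by rewrite -addnBAC // modnDr.
Qed.

(** c_0 does not enter the B_n and may be small, hence [behead] and the index [n.+1]. *)
Lemma all_eventually_periodic (P : pred rat) pre per n : (0 < size per)%N ->
  all P (behead pre) -> all P per -> P (eventually_periodic pre per n.+1).
Proof.
move=> per_gt0 /all_nthP pre_P /all_nthP per_P; rewrite /eventually_periodic.
case: ifP => n_lt; last by rewrite per_P // ltn_mod.
by rewrite -nth_behead pre_P // size_behead -ltnS (ltn_predK n_lt).
Qed.

(** Taking s to be f times the limit selects the sign of the square root of e. The base relations
    concern A_(k-1) and A_k, the last pair before the period enters. *)
Lemma periodic_cf_sqrt (p : nat) (p_pr : prime p) (pre per : seq rat) (k : nat)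
    (e f a b : rat) (c := eventually_periodic pre per) (l := size per)
    (D := e / f ^+ 2) :
  size pre = k.+1 -> (0 < l)%N -> f != 0 ->
  all (fun q => p%:R <= padic_abs p q) (behead pre ++ per) ->
  a ^+ 2 - D * b ^+ 2 = 1 ->
  (forall i, (i < 2)%N ->
    cf_num c (i + k + l) = a * cf_num c (i + k) + D * b * cf_den c (i + k) /\
    cf_den c (i + k + l) = b * cf_num c (i + k) + a * cf_den c (i + k)) ->
  exists2 s : Qp p_pr, s ^+ 2 = Qp_rat p_pr e & padic_cf c (s / Qp_rat p_pr f).
Proof.
rewrite all_cat => pre_size l_gt0 f0 /andP[pre_ge per_ge] ab1 base.
have [|M M_ge] := cf_norm_bounded p c k l D a b l_gt0 _ ab1 base.
  by move=> n n_gt; rewrite /c eventually_periodicD // pre_size.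
have [|x x2 x_cf] := padic_cf_sqrt p p_pr c _ D M M_ge.
  move=> n; exact: (all_eventually_periodic (fun q => p%:R <= padic_abs p q)).
exists (x * Qp_rat p_pr f); last by rewrite mulfK // fmorph_eq0.
by rewrite exprMn x2 Qp_ratE -rmorphXn -rmorphM divfK // expf_neq0.
Qed.

(** * Absolute values of the partial quotients *)

Section PadicAbsPowers.
Variables (p : nat) (p_pr : prime p) (p_odd : odd p).

Lemma padic_abs_prime : padic_abs p p%:R = p%:R^-1.
Proof.
rewrite -[p%:R]/(p%:Z%:~R) padic_abs_int ?eqz_nat -?lt0n ?prime_gt0 //.
by rewrite absz_nat logn_prime // eqxx.
Qed.

Lemma padic_abs2 : padic_abs p 2 = 1.
Proof.
rewrite -[2]/(2%:Z%:~R) padic_abs_int // absz_nat logn_prime //.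
by case: eqP => // p2; move: p_odd; rewrite p2.
Qed.

Lemma padic_abs_expV n : padic_abs p (1 / p%:R ^+ n) = p%:R ^+ n.
Proof.
rewrite mul1r padic_absV //; elim: n => [|n IH].
  by rewrite !expr0 padic_abs1 invr1.
by rewrite !exprS padic_absM // padic_abs_prime invfM invrK IH.
Qed.

Lemma padic_abs_2V : padic_abs p (2 / p%:R) = p%:R.
Proof.
by rewrite padic_absM // padic_abs2 padic_absV // padic_abs_prime invrK mul1r.
Qed.

(** The term 2/p dominates, as |2/p| = p > 1. With x = 1 or -1 this covers, up to sign, all the
    quotients mixing a unit with 2/p. *)
Lemma padic_absD_2V x : padic_abs p x = 1 -> padic_abs p (x + 2 / p%:R) = p%:R.
Proof.
move=> x1; rewrite -[RHS]padic_abs_2V; apply: padic_dist_abs => //.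
by rewrite addrK x1 padic_abs_2V ltr1n prime_gt1.
Qed.
End PadicAbsPowers.

(** * The three expansions *)

Theorem theorem6p1 (p : nat) (p_pr : prime p) (p_odd : odd p) :
  [/\ (3 <= p)%N -> forall t : nat, (2 <= t)%N ->
        exists2 s : Qp p_pr, s ^+ 2 = 1 - p%:R ^+ (t + 2) &
          padic_cf
            (eventually_periodic
               [:: (p%:R ^+ 2 - 1) / (2 * p%:R)]
               [:: - (2 / p%:R); - (1 / p%:R ^+ (t - 1)); 2 / p%:R; - (1 / p%:R)])
            (s / (2 * p%:R)),
      (5 <= p)%N -> forall t : nat, (3 <= t)%N ->
        exists2 s : Qp p_pr, s ^+ 2 = p%:R ^+ t + 1 &
          padic_cf
            (eventually_periodic
               [:: - ((p%:R - 1) / 2); 2 / p%:R]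
               [:: - (1 / p%:R ^+ (t - 2)); 1 - 2 / p%:R; - 1 - 2 / p%:R;
                   1 / p%:R ^+ (t - 2); - 1 + 2 / p%:R; 1 + 2 / p%:R])
            (s / 2)
    & (5 <= p)%N -> forall t : nat, (3 <= t)%N ->
        exists2 s : Qp p_pr, s ^+ 2 = p%:R ^+ t + 1 &
          padic_cf
            (eventually_periodic
               [:: (p%:R ^+ (t - 1) - 1) / (2 * p%:R ^+ (t - 2))]
               [:: 1 - 2 / p%:R; - 1 - 2 / p%:R; 1 / p%:R ^+ (t - 2);
                   - 1 + 2 / p%:R; 1 + 2 / p%:R; - (1 / p%:R ^+ (t - 2))])
            (s / (2 * p%:R ^+ (t - 2)))].
Proof.
have p0 : p%:R != 0 :> rat by rewrite pnatr_eq0 -lt0n prime_gt0.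
have inv_ge n : p%:R <= padic_abs p (1 / p%:R ^+ n.+1).
  by rewrite padic_abs_expV // ler_eXnr // ler1n prime_gt0.
have two_inv_ge : p%:R <= padic_abs p (2 / p%:R) by rewrite padic_abs_2V.
have add_ge x : padic_abs p x = 1 -> p%:R <= padic_abs p (x + 2 / p%:R).
  by move=> x1; rewrite padic_absD_2V.
have pred_ge : p%:R <= padic_abs p (1 - 2 / p%:R).
  by rewrite -padic_absN opprB addrC add_ge // padic_absN padic_abs1.
have predN_ge : p%:R <= padic_abs p (- 1 - 2 / p%:R).
  by rewrite -padic_absN opprB addrC opprK add_ge // padic_abs1.
split=> _ t.
- case: t => [|[|t]] // _; rewrite !subSS subn0 !addn2.
  have pt : p%:R ^+ t != 0 :> rat by rewrite expf_neq0.
  (* Here [t] has been lowered by 2. With P = p^(t+4), s^2 = 1 - P and sqrt(D) = s / (2p), the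
     multiplier a + b sqrt(D) is (s - 1) / (s + 1), of norm 1. *)
  have [||||s s2 s_cf] := @periodic_cf_sqrt p p_pr
    [:: (p%:R ^+ 2 - 1) / (2 * p%:R)]
    [:: - (2 / p%:R); - (1 / p%:R ^+ t.+1); 2 / p%:R; - (1 / p%:R)] 0
    (1 - p%:R ^+ t.+4) (2 * p%:R)
    (1 - 2 / p%:R ^+ t.+4) (4 / p%:R ^+ t.+3) erefl isT.
  + by rewrite mulf_neq0.
  + by rewrite /= !padic_absN inv_ge two_inv_ge (inv_ge 0).
  + by rewrite !exprS; field; rewrite p0 pt.
  (* Unrolling one period from A_(-1) and A_0 leaves identities of rational functions in p and
     p^t. *)
  + case=> [|[|]] // _;
      rewrite !addn0 ?add0n /= /eventually_periodic /= !exprS;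
      by split; field; rewrite p0 pt.
  + exists s; first by rewrite s2 rmorphB rmorph1 rmorphXn rmorph_nat.
    by rewrite rmorphM !rmorph_nat in s_cf.
- case: t => [|[|[|t]]] // _; rewrite !subSS subn0.
  have pt : p%:R ^+ t != 0 :> rat by rewrite expf_neq0.
  (* Here [t] has been lowered by 3. With q = p^(t+3), s^2 = q + 1 and sqrt(D) = s / 2, the
     multiplier is -(s + 1)^4 / q^2 = -((s + 1) / (s - 1))^2. The two-term preperiod gives k = 1. *)
  have [||||s s2 s_cf] := @periodic_cf_sqrt p p_pr
    [:: - ((p%:R - 1) / 2); 2 / p%:R]
    [:: - (1 / p%:R ^+ t.+1); 1 - 2 / p%:R; - 1 - 2 / p%:R;
        1 / p%:R ^+ t.+1; - 1 + 2 / p%:R; 1 + 2 / p%:R] 1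
    (p%:R ^+ t.+3 + 1) 2
    (- 1 - 8 / p%:R ^+ t.+3 - 8 / (p%:R ^+ t.+3) ^+ 2)
    (- 8 * (p%:R ^+ t.+3 + 2) / (p%:R ^+ t.+3) ^+ 2) erefl isT.
  + by [].
  + by rewrite /= !padic_absN inv_ge two_inv_ge pred_ge predN_ge !add_ge
      ?padic_absN ?padic_abs1.
  + by rewrite !exprS; field; rewrite p0 pt.
  + by case=> [|[|]] // _; rewrite /= /eventually_periodic /= !exprS;
      split; field; rewrite p0 pt.
  + exists s; first by rewrite s2 rmorphD rmorph1 rmorphXn rmorph_nat.
    by rewrite rmorph_nat in s_cf.
- case: t => [|[|[|t]]] // _; rewrite !subSS !subn0.
  have pt : p%:R ^+ t != 0 :> rat by rewrite expf_neq0.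
  (* Now sqrt(D) = s / (2 p^(t+1)) and the multiplier is -((s - 1) / (s + 1))^2, the conjugate,
     hence the inverse, of the one in the second expansion. *)
  have [||||s s2 s_cf] := @periodic_cf_sqrt p p_pr
    [:: (p%:R ^+ t.+2 - 1) / (2 * p%:R ^+ t.+1)]
    [:: 1 - 2 / p%:R; - 1 - 2 / p%:R; 1 / p%:R ^+ t.+1;
        - 1 + 2 / p%:R; 1 + 2 / p%:R; - (1 / p%:R ^+ t.+1)] 0
    (p%:R ^+ t.+3 + 1) (2 * p%:R ^+ t.+1)
    (- 1 - 8 / p%:R ^+ t.+3 - 8 / (p%:R ^+ t.+3) ^+ 2)
    (8 * (p%:R ^+ t.+3 + 2) / (p%:R ^+ t.+3 * p%:R ^+ 2)) erefl isT.
  + by rewrite mulf_neq0 // expf_neq0.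
  + by rewrite /= !padic_absN inv_ge pred_ge predN_ge !add_ge
      ?padic_absN ?padic_abs1.
  + by rewrite !exprS; field; rewrite p0 pt.
  + case=> [|[|]] // _;
      rewrite !addn0 ?add0n /= /eventually_periodic /= !exprS;
      by split; field; rewrite p0 pt.
  + exists s; first by rewrite s2 rmorphD rmorph1 rmorphXn rmorph_nat.
    by rewrite rmorphM rmorphXn !rmorph_nat in s_cf.
Qed.
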